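(* Let $X$ be a Polish space, $\rho$ an infinite, diffuse, locally finite measure on $X$, $(Y_t)_{0\le t<1}$ the spatial Chinese restaurant-like process with parameter $\rho$, and $(B_n)_n$ an increasing sequence of bounded measurable sets with $\bigcup_nB_n=X$ and $\rho(B_n)>0$. Put $V_{B_n,t}=U_B(Y_t)\big|_{B=B_n}/\rho(B_n)$. Then for each $t\in[0,1)$, almost surely, $$V_t=\lim_{n\to\infty}V_{B_n,t}=\sum_{j\ge1}\frac{t^j}{j}\,\delta_j$$ in the vague topology of measures on $\mathbb N$.
   Context: $\mathbb N=\{1,2,\dots\}$. $X$ is a Polish space with its bounded Borel sets; $\mathcal M(X)$ is the space of locally finite measures (finite on bounded sets) with the vague topology, $\mathcal M^{\cdot\cdot}(X)$ its closed subset of point measures. Vague convergence of measures on the discrete space $\mathbb N$ is convergence of the weight at each $j\in\mathbb N$. Pólya sum process: for $z\in[0,1)$ and $\kappa\in\mathcal M(X)$, $\mathsf S_{z,\kappa}$ denotes the unique law on $\mathcal M^{\cdot\cdot}(X)$ satisfying, for all measurable $h\ge 0$, $\iint h(x,\mu)\,\mu(\mathrm dx)\,\mathsf S_{z,\kappa}(\mathrm d\mu)=\iint h(x,\mu+\delta_x)\,z(\kappa+\mu)(\mathrm dx)\,\mathsf S_{z,\kappa}(\mathrm d\mu)$. Spatial Chinese restaurant-like process with parameter $\rho\in\mathcal M(X)$: the Markov process $(Y_t)_{0\le t<1}$ with values in $\mathcal M^{\cdot\cdot}(X)$ and càdlàg, increasing paths ($Y_s\le Y_t$ for $s\le t$)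 such that $Y_0=0$ and, for $0\le s<t<1$, the conditional law of $Y_t-Y_s$ given $Y_s$ is $\mathsf S_{\frac{t-s}{1-s},\,\rho+Y_s}$. For a bounded Borel set $B$ and $\mu\in\mathcal M^{\cdot\cdot}(X)$, $U_B(\mu)$ is the finite point measure on $\mathbb N$ whose weight at $j$ is the number of $x\in B$ with $\mu(\{x\})=j$. *)

(* Defs.v *)
From HB Require Import structures.
From mathcomp Require Import all_boot all_order all_algebra.
From mathcomp Require Import all_classical all_reals all_analysis.
From mathcomp Require Import measurable_realfun finmap.

Set Implicit Arguments.
Unset Strict Implicit.
Unset Printing Implicit Defensive.

Import Order.TTheory GRing.Theory Num.Theory.
Import numFieldNormedType.Exports.

Local Open Scope classical_set_scope.
Local Open Scope ring_scope.
Local Open Scope ereal_scope.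

HB.mixin Record isSeparable T & Topological T := {
  separable : exists2 D : set T, countable D & dense D
}.

(* Complete separable metric spaces: a Polish space together with the complete
   metric that says which sets are bounded. They are pointed because
   measurableType requires it. *)
#[short(type="polishType")]
HB.structure Definition Polish (R : realType) :=
  { T of Metric R T & CompletePseudoMetric R T & Pointed T & isSeparable T }.

Section point_measures.
Context (R : realType) (X : polishType R).

Definition borel : measurableType _ := g_sigma_algebraType (@open X).

Definition is_bounded (A : set X) : Prop :=
  exists (x : X) (r : R), A `<=` ball x r.

Definition locally_finite (mu : {measure set borel -> \bar R}) : Prop :=
  forall B : set borel, measurable B -> is_bounded B -> mu B < +oo.

Definition diffuse (mu : {measure set borel -> \bar R}) : Prop :=
  forall x : borel, mu [set x] = 0.

(* Vague convergence is tested on the nonnegative bounded continuous functions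
   with bounded support. *)
Definition test_function (f : X -> R) : Prop :=
  [/\ continuous f, (forall x, (0 <= f x)%R),
      exists M : R, forall x, (f x <= M)%R &
      exists2 B : set X, is_bounded B & forall x, ~ B x -> f x = 0%R].

Definition vague_cvg (T : Type) (F : set_system T)
    (mu : T -> {measure set borel -> \bar R})
    (nu : {measure set borel -> \bar R}) : Prop :=
  forall f : X -> R, test_function f ->
    \int[mu s]_x (f x)%:E @[s --> F] --> \int[nu]_x (f x)%:E.

(* Natural-number values on bounded Borel sets; this includes local
   finiteness. *)
Definition is_point_measure (mu : {measure set borel -> \bar R}) : Prop :=
  forall B : set borel, measurable B -> is_bounded B ->
    exists n : nat, mu B = n%:R%:E.

Record pointMeasure : Type := PointMeasure {
  pm_measure :> {measure set borel -> \bar R} ;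
  pm_measureP : is_point_measure pm_measure
}.

Lemma is_point_measure0 : is_point_measure mzero.
Proof. by move=> B _ _; exists 0%N. Qed.

HB.instance Definition _ := gen_eqMixin pointMeasure.
HB.instance Definition _ := gen_choiceMixin pointMeasure.
HB.instance Definition _ :=
  isPointed.Build pointMeasure (PointMeasure is_point_measure0).

(* The sigma-algebra on point measures is generated by the evaluations
   mu |-> mu B at bounded Borel sets B. *)
Definition pm_evaluations : set (set pointMeasure) :=
  \bigcup_(B in [set B : set borel | measurable B /\ is_bounded B])
    preimage_set_system setT (fun mu : pointMeasure => mu B) measurable.

Definition pm_display : measure_display.
Proof. by constructor. Qed.

HB.instance Definition _ :=
  @isMeasurable.Build pm_display pointMeasure <<s pm_evaluations >>
    (@sigma_algebra0 _ setT pm_evaluations)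
    (@sigma_algebraC _ pm_evaluations)
    (@sigma_algebra_bigcup _ setT pm_evaluations).

Lemma is_point_measure_add_dirac (mu : pointMeasure) (x : borel) :
  is_point_measure (measure_add mu (dirac x)).
Proof.
move=> B mB bB; have [n muB] := pm_measureP mu mB bB.
exists (n + (x \in B))%N; transitivity (mu B + dirac x B).
  exact: measure_addE.
by rewrite muB /dirac indicE natrD EFinD.
Qed.

Definition add_point (mu : pointMeasure) (x : borel) : pointMeasure :=
  PointMeasure (is_point_measure_add_dirac mu x).

(* S is the law of the Polya sum process with parameters z and kappa. The
   identity has a unique solution for 0 <= z < 1 and kappa locally finite. *)
Definition polya_sum (z : R) (kappa : {measure set borel -> \bar R})
    (S : probability pointMeasure R) : Prop :=
  forall h : borel * pointMeasure -> \bar R,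
    measurable_fun setT h -> (forall p, 0 <= h p) ->
    \int[S]_mu (\int[mu]_x h (x, mu)) =
    \int[S]_mu (z%:E * \int[measure_add kappa mu]_x h (x, add_point mu x)).

End point_measures.

Section conditioning.
Context (R : realType) d (Omega : measurableType d) (P : probability Omega R).

(* f is a version of P(E | G), for a sub-sigma-algebra G. *)
Definition is_cond_prob (G : set (set Omega)) (E : set Omega)
    (f : Omega -> \bar R) : Prop :=
  [/\ forall D : set (\bar R), measurable D -> G (f @^-1` D),
      P.-integrable setT f &
      forall A, G A -> P (E `&` A) = \int[P]_(w in A) f w].

(* K is a regular version of the conditional law of Z given G. *)
Definition is_cond_law d' (T : measurableType d') (G : set (set Omega))
    (Z : Omega -> T) (K : Omega -> probability T R) : Prop :=
  forall A : set T, measurable A -> is_cond_prob G (Z @^-1` A) (K ^~ A).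

Definition generated d' (T : measurableType d') (Z : Omega -> T) :
  set (set Omega) := preimage_set_system setT Z measurable.

Definition natural_filtration d' (T : measurableType d') (Y : R -> Omega -> T)
    (s : R) : set (set Omega) :=
  <<s \bigcup_(u in `[0%R, s]) generated (Y u) >>.

Definition is_markov d' (T : measurableType d') (Y : R -> Omega -> T) : Prop :=
  forall s t : R, (0 <= s)%R -> (s < t)%R -> (t < 1)%R ->
  forall A : set T, measurable A ->
    exists2 f : Omega -> \bar R,
      is_cond_prob (generated (Y s)) (Y t @^-1` A) f &
      is_cond_prob (natural_filtration Y s) (Y t @^-1` A) f.

End conditioning.

(* Time is indexed by R and only [0, 1[ matters. *)
Definition cadlag (R : realType) (X : polishType R)
    (y : R -> pointMeasure X) : Prop :=
  (forall t : R, (0 <= t)%R -> (t < 1)%R ->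
     vague_cvg t^'+ (fun s => y s : {measure set _ -> \bar R}) (y t)) /\
  (forall t : R, (0 < t)%R -> (t < 1)%R -> exists nu : pointMeasure X,
     vague_cvg t^'- (fun s => y s : {measure set _ -> \bar R}) nu).

(* Two library measures can differ off the sigma-algebra, so relations between
   measures are stated on measurable sets. Accordingly Z = Y_t - Y_s is
   expressed by Y_t = Y_s + Z. *)
Record spatial_crp (R : realType) (X : polishType R)
    (rho : {measure set (borel X) -> \bar R})
    d (Omega : measurableType d) (P : probability Omega R)
    (Y : R -> Omega -> pointMeasure X) : Prop := {
  crp_measurable : forall t : R, (0 <= t)%R -> (t < 1)%R ->
    measurable_fun setT (Y t) ;
  crp_markov : is_markov P Y ;
  crp_cadlag : forall w, cadlag (Y ^~ w) ;
  crp_increasing : forall s t : R, (0 <= s)%R -> (s <= t)%R -> (t < 1)%R ->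
    forall w (A : set (borel X)), measurable A -> Y s w A <= Y t w A ;
  crp_start : forall w (A : set (borel X)), measurable A -> Y 0%R w A = 0 ;
  crp_transition : forall s t : R, (0 <= s)%R -> (s < t)%R -> (t < 1)%R ->
    exists (Z : Omega -> pointMeasure X)
           (K : Omega -> probability (pointMeasure X) R),
      [/\ forall w (A : set (borel X)), measurable A ->
            Y t w A = Y s w A + Z w A,
          forall w, polya_sum ((t - s) / (1 - s)) (measure_add rho (Y s w))
                      (K w) &
          is_cond_law P (generated (Y s)) Z K]
}.

(* Measures on {1, 2, ...} are measures on nat without mass at 0. *)
Section measures_on_positive_integers.
Context (R : realType).

Definition weighted_sum (c : nat -> {nonneg R}) : {measure set nat -> \bar R} :=
  mseries (fun j => mscale (c j) (dirac j)) 1.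

Definition vague_cvg_nat (T : Type) (F : set_system T)
    (mu : T -> {measure set nat -> \bar R}) (nu : {measure set nat -> \bar R})
    : Prop :=
  forall j : nat, (0 < j)%N -> mu s [set j] @[s --> F] --> nu [set j].

Definition limit_measure (t : R) (t0 : (0 <= t)%R) :
    {measure set nat -> \bar R} :=
  weighted_sum (fun j => NngNum (divr_ge0 (exprn_ge0 j t0) (ler0n R j))).

End measures_on_positive_integers.

Section multiplicities.
Context (R : realType) (X : polishType R).
Implicit Types (B : set (borel X)) (mu : pointMeasure X).

(* For B bounded and j > 0 the set below is finite, and fset_set turns it into
   a finite set with the same elements. *)
Definition multiplicity_count B mu (j : nat) : nat :=
  #|` fset_set [set x : borel X | B x /\ mu [set x] = j%:R%:E] |.

Definition U B mu : {measure set nat -> \bar R} :=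
  weighted_sum (fun j => ((multiplicity_count B mu j)%:R%:nng)%R).

Lemma inv_mass_ge0 (rho : {measure set (borel X) -> \bar R}) B :
  (0 <= (fine (rho B))^-1)%R.
Proof. by rewrite invr_ge0 fine_ge0. Qed.

Definition V (rho : {measure set (borel X) -> \bar R}) B mu :
    {measure set nat -> \bar R} :=
  mscale (NngNum (inv_mass_ge0 rho B)) (U B mu).

End multiplicities.

(* Main.v *)
Require Import Defs.
From HB Require Import structures.
From mathcomp Require Import finmap.
From mathcomp Require Import all_boot all_order all_algebra.
From mathcomp Require Import all_classical all_reals all_analysis.
From mathcomp Require Import measurable_realfun ring.

Set Implicit Arguments.
Unset Strict Implicit.
Unset Printing Implicit Defensive.

Import Order.TTheory GRing.Theory Num.Theory.
Import numFieldNormedType.Exports.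

Local Open Scope classical_set_scope.
Local Open Scope ring_scope.
Local Open Scope ereal_scope.

(** The statement concerns a single time t; for t = 0 there are no atoms and all
limits are 0, so let t > 0. By the transition property from s = 0, Y_t agrees on
measurable sets with a random point measure Z whose conditional law given Y_0
is, for every outcome, a Polya sum law S with parameters t and kappa = rho + Y_0,
where kappa and rho have the same values. Hence it is enough to show that a
fixed measurable set of configurations, those for which the frequencies
converge, has full mass under each such S.

Write a_k for the mass that a configuration mu puts on the atoms of B of weight
exactly k; a_k is k times the number of these atoms. In the Poisson picture the
numbers a_k / k are independent Poisson variables with means
z^k / k * kappa(B). Their first two moments come straight out of the defining
integral identity of the Polya sum law. Test it on
h(x, mu) = 1[x in B, mu{x} = i+1] F(mu). Adding a point at x turns an atom of
weight i into one of weight i+1, so if adding such a point changes F by a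
constant c, then

    E[a_(i+1) F] = z E[(kappa(B) 1[i = 0] + a_i) (F + c)],

where kappa is diffuse and mu is purely atomic, so that kappa only sees the
points of weight 0 and mu only the others (polya_sum_atom_recursion). With F = 1
this gives E[a_k] = z^k kappa(B) =: m_k. With F = a_k the constant c is 0 for
i+1 < k, whence E[a_i a_k] = m_i m_k for i < k, and it is k for i+1 = k, whence
E[a_k^2] = m_k^2 + k m_k. So the variance of a_k is k m_k
(polya_sum_variance), proportional to kappa(B).

The strong law (monotone_strong_law) now follows from Chebyshev-type summation
along a subsequence, because a_k is increasing in B. The sequence kappa(B_n) may
jump by arbitrarily large factors, so one subsequence with kappa(B_n) of order
k^2 is not enough to sandwich the others. Instead one uses, for each k, both the
first and the last index for which kappa(B_n) lies between (k+1)^2 and (k+2)^2: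
between these two indices kappa(B_n) changes only by a factor that tends to 1,
and the relative variances along both subsequences are summable. *)

(** * Atoms of point measures on a separable metric space *)

Section point_measures_are_atomic.
Context (R : realType) (X : polishType R).
Implicit Types (mu : pointMeasure X) (x : X).

Lemma measurable_open (A : set X) : open A -> measurable (A : set (borel X)).
Proof. by move=> oA; exact: sub_sigma_algebra. Qed.

Lemma measurable_singleton (x : borel X) : measurable [set x].
Proof.
rewrite -[[set x]]setCK; apply: measurableC; apply: measurable_open.
rewrite openC; change (closed [set (x : X)]); apply: accessible_closed_set1.
exact/hausdorff_accessible/metric_hausdorff.
Qed.

Lemma is_boundedS (A C : set X) : A `<=` C -> is_bounded C -> is_bounded A.
Proof. by move=> AC [x [r Cr]]; exists x, r; exact: subset_trans Cr. Qed.

Lemma is_bounded_singleton x : is_bounded [set x].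
Proof. by exists x, 1%R => _ ->; exact: ballxx. Qed.

(** Balls of radius 1/(m+1) around a countable dense set; interiors are taken to
make the sets open, and a small radius keeps them bounded. *)
Lemma countable_bounded_base : exists W : nat -> set X,
  [/\ forall n, open (W n), forall n, is_bounded (W n) &
      forall x A, nbhs x A -> exists2 n, W n x & W n `<=` A].
Proof.
have [D cD dD] : exists2 D : set X, countable D & dense D by exact: separable.
have /pfcard_geP[D0|[f]] := cD.
  have [z []] : (setT `&` D) !=set0.
    by apply: dD; [exists point | exact: openT].
  by rewrite D0.
pose W n := if unpickle n is Some (i, m)
  then ((ball (f i) (m.+1%:R^-1))%R)° else (set0 : set X).
exists W; split.
- move=> n; rewrite /W; case: unpickle => [[i m]|]; last exact: open0.
  exact: open_interior.
- move=> n; rewrite /W; case: unpickle => [[i m]|]; last by exists point, 1%R.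
  by exists (f i), (m.+1%:R^-1)%R; exact: interior_subset.
move=> x A /nbhs_ballP[e /= e0 xeA].
pose m := Num.truncn (2 / e)%R.
have me : ((m.+1%:R^-1 : R) < e / 2)%R.
  rewrite -[ltRHS]invrK ltf_pV2 ?posrE ?invr_gt0 ?divr_gt0 //.
  by rewrite invf_div truncnS_gt.
have r0 : (0 < m.+1%:R^-1 / 2 :> R)%R by rewrite divr_gt0.
have [y [xy Dy]] : ((ball x (m.+1%:R^-1 / 2))%R)° `&` D !=set0.
  apply: dD; last exact: open_interior.
  by exists x; exact: nbhsx_ballx.
move/interior_subset in xy.
have [i _ fiy] := 'surj_f Dy.
exists (pickle (i, m)); rewrite /W pickleK fiy.
  suff : ball x (m.+1%:R^-1 / 2)%R `<=` ball y (m.+1%:R^-1)%R.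
    by move/interiorS; apply; exact: nbhsx_ballx.
  move=> z xz; rewrite [X in ball y X](splitr (m.+1%:R^-1 : R)%R).
  exact: ball_triangle (ball_sym xy) xz.
move=> z /interior_subset yz; apply: xeA.
rewrite [X in ball x X](splitr e); apply: (ball_triangle (y := y)).
  apply: le_ball xy; rewrite ltW// (le_lt_trans _ me)// ler_piMr//.
  by rewrite invf_le1 // ler1n.
by apply: le_ball yz; exact: ltW.
Qed.

Lemma point_measure_singleton mu (x : borel X) :
  exists n : nat, mu [set x] = n%:R%:E.
Proof.
apply: pm_measureP; [exact: measurable_singleton | exact: is_bounded_singleton].
Qed.

(** Continuity from above along shrinking balls makes the mass of a small
neighbourhood of x come within 1 of the mass of x; both are integers, hence
equal. This is what turns statements about single points into statements about
countably many open sets. *)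
Lemma singleton_mass_nbhs (W : nat -> set X) mu (x : borel X) :
    (forall n, open (W n)) -> (forall n, is_bounded (W n)) ->
    (forall (x : X) A, nbhs x A -> exists2 n, W n x & W n `<=` A) ->
  exists2 n, W n x & mu (W n) = mu [set x].
Proof.
move=> oW bW baseW.
pose F n := ((ball (x : X) (n.+1%:R^-1))%R)° : set (borel X).
have mF n : measurable (F n) by apply: measurable_open; exact: open_interior.
have bF n : is_bounded (F n).
  by exists x, (n.+1%:R^-1)%R; exact: interior_subset.
have xF n : F n x by apply: nbhsx_ballx; rewrite invr_gt0.
have capF : \bigcap_n F n = [set x].
  apply/seteqP; split => [y Fy|_ -> //].
  apply: esym; apply: metric_hausdorff => A C /nbhs_ballP[e /= e0 xeA] yC.
  exists y; split; last exact: nbhs_singleton.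
  apply: xeA; have /interior_subset := Fy (Num.truncn e^-1)%R Logic.I.
  apply: le_ball; rewrite -[leRHS]invrK lef_pV2 ?posrE ?invr_gt0//.
  by rewrite ltW// truncnS_gt.
have cvgF : mu \o F @ \oo --> mu [set x].
  rewrite -capF; apply: nonincreasing_cvg_mu => //.
  - by have [k ->] := pm_measureP mu (mF 0%N) (bF 0%N); rewrite ltry.
  - by rewrite capF; exact: measurable_singleton.
  - move=> n m nm; apply/subsetPset/interiorS/le_ball.
    by rewrite lef_pV2 ?posrE// ler_nat.
have [k muk] := point_measure_singleton mu x.
have [n muF] : exists n, mu (F n) < k.+1%:R%:E.
  have : \forall n \near \oo, mu (F n) < k.+1%:R%:E.
    apply: (cvgF [set z | z < k.+1%:R%:E]); apply: open_nbhs_nbhs.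
    by split; [exact: open_ereal_lt_ereal | rewrite /= muk lte_fin ltr_nat].
  by case=> n _ /(_ n (leqnn n)) ?; exists n.
have [i Wix WiF] : exists2 i, W i x & W i `<=` F n.
  by apply: baseW; exact: open_nbhs_nbhs (conj (open_interior _) (xF n)).
exists i => //.
have mW := measurable_open (oW i).
have [l mul] := pm_measureP mu mW (bW i).
apply/eqP; rewrite eq_le; apply/andP; split; last first.
  apply: le_measure; rewrite ?inE//; first exact: measurable_singleton.
  by move=> _ ->.
rewrite muk mul lee_fin ler_nat -ltnS -(ltr_nat R) -lte_fin -mul.
by apply: le_lt_trans muF; apply: le_measure; rewrite ?inE.
Qed.

End point_measures_are_atomic.

(** * The points of a given multiplicity *)

Section atoms.
Context (R : realType) (X : polishType R).
Implicit Types (mu : pointMeasure X) (B : set (borel X)) (k : nat).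

Definition atoms B mu k : set (borel X) :=
  [set x | B x /\ mu [set x] = k%:R%:E].

Lemma measurable_evaluation B : measurable B -> is_bounded B ->
  measurable_fun [set: pointMeasure X] (fun mu => mu B).
Proof.
move=> mB bB _ A mA; apply: sub_sigma_algebra; exists B => //.
by exists A.
Qed.

(** Since small basic sets around x have the same mass as x, this set is a
countable union of measurable rectangles, one for each basic set. *)
Lemma measurable_singleton_mass_le k :
  measurable [set p : pointMeasure X * borel X | p.1 [set p.2] <= k%:R%:E].
Proof.
have [W [oW bW baseW]] := countable_bounded_base X.
rewrite (_ : mkset _ =
    \bigcup_n ([set mu : pointMeasure X | mu (W n) <= k%:R%:E] `*` W n)).
  apply: bigcupT_measurable => n; apply: measurableX.
    rewrite -[X in measurable X]setTI; apply: emeasurable_fun_infty_c => //.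
    by apply: measurable_evaluation => //; exact: measurable_open.
  exact: (measurable_open (oW n)).
apply/seteqP; split => [[mu x] /= mux|[mu x] [n _ [/= muW Wx]]].
  have [n Wnx muW] := singleton_mass_nbhs mu x oW bW baseW.
  by exists n => //; split => //=; rewrite muW.
apply: le_trans muW; apply: le_measure; rewrite ?inE.
- exact: measurable_singleton.
- exact: measurable_open.
- by move=> _ ->.
Qed.

Lemma measurable_singleton_mass_eq k :
  measurable [set p : pointMeasure X * borel X | p.1 [set p.2] = k%:R%:E].
Proof.
case: k => [|k].
  rewrite (_ : mkset _ =
      [set p : pointMeasure X * borel X | p.1 [set p.2] <= 0%:R%:E]).
    exact: measurable_singleton_mass_le.
  apply/seteqP; split => [p /= -> //|p /= p0].
  by apply/eqP; rewrite eq_le p0 measure_ge0.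
rewrite (_ : mkset _ =
    [set p : pointMeasure X * borel X | p.1 [set p.2] <= k.+1%:R%:E] `\`
    [set p : pointMeasure X * borel X | p.1 [set p.2] <= k%:R%:E]).
  by apply: measurableD; exact: measurable_singleton_mass_le.
apply/seteqP; split => [[mu x] /= ->|[mu x] /=].
  by split => //; rewrite lee_fin ler_nat ltnn.
have [n ->] := point_measure_singleton mu x.
rewrite !lee_fin !ler_nat => -[nk /negP]; rewrite -ltnNge => kn.
by congr _%:R%:E; apply/eqP; rewrite eqn_leq nk.
Qed.

Lemma measurable_graph_atoms B k : measurable B ->
  measurable [set p : pointMeasure X * borel X | atoms B p.1 k p.2].
Proof.
move=> mB; rewrite (_ : mkset _ = (setT `*` B) `&`
    [set p : pointMeasure X * borel X | p.1 [set p.2] = k%:R%:E]).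
  apply: measurableI; last exact: measurable_singleton_mass_eq.
  exact: measurableX.
by apply/seteqP; split => [p [Bp pk] //|p [[_ Bp] pk]].
Qed.

Lemma measurable_atoms B mu k : measurable B -> measurable (atoms B mu k).
Proof.
move=> /(measurable_graph_atoms k) /(measurable_xsection mu).
by congr measurable; apply/seteqP; split => x; rewrite /xsection/= inE.
Qed.

Lemma is_bounded_atoms B mu k : is_bounded B -> is_bounded (atoms B mu k).
Proof. by apply: is_boundedS => x []. Qed.

(** Each point of mass 0 lies in a basic set of mass 0, and there are countably
many of those: a point measure is purely atomic. *)
Lemma null_atoms0 B mu : measurable B -> mu (atoms B mu 0) = 0.
Proof.
move=> mB; have [W [oW bW baseW]] := countable_bounded_base X.
have mW n : measurable (W n : set (borel X)) by exact: measurable_open.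
pose N n : set (borel X) := if mu (W n) == 0 then W n else set0.
have mN n : measurable (N n) by rewrite /N; case: ifP.
have mUN : measurable (\bigcup_n N n) by exact: bigcupT_measurable.
apply: (@subset_measure0 _ _ _ mu _ (\bigcup_n N n)) => //.
- exact: measurable_atoms.
- move=> x [_ mux]; have [n Wnx muW] := singleton_mass_nbhs mu x oW bW baseW.
  by exists n => //; rewrite /N muW mux eqxx.
- apply: measure_negligible => //; apply: negligible_bigcup => n.
  apply/negligibleP => //.
  by rewrite /N; case: eqP => //; rewrite measure0.
Qed.

Lemma measure_finite_set (nu : {measure set (borel X) -> \bar R})
    (A : set (borel X)) : finite_set A ->
  nu A = \sum_(x \in A) nu [set x].
Proof.
move=> finA; rewrite -measure_fin_bigcup//.
- by congr (nu _); apply/seteqP; split => [x Ax|x [y Ay ->]//]; exists x.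
- by move=> x y _ _ [z [-> ->]].
- by move=> x _; exact: measurable_singleton.
Qed.

Lemma measurable_finite_set (A : set (borel X)) : finite_set A -> measurable A.
Proof.
move=> finA; rewrite (_ : A = \bigcup_(x in A) [set x]).
  by apply: fin_bigcup_measurable => // x _; exact: measurable_singleton.
by apply/seteqP; split => [x Ax|x [y Ay ->]//]; exists x.
Qed.

Lemma sum_finite_set_cst (A : set (borel X)) (c : R) : finite_set A ->
  \sum_(x \in A) c%:E = (c * #|` fset_set A|%:R)%:E.
Proof.
move=> finA; rewrite fsbig_finite//= card_fset_sum1 sumEFin natr_sum mulr_sumr.
by under [in RHS]eq_bigr do rewrite mulr1.
Qed.

(** Each charged point has mass at least 1, while B has finite mass. *)
Lemma finite_charged B mu : measurable B -> is_bounded B ->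
  finite_set [set x | B x /\ mu [set x] != 0].
Proof.
move=> mB bB; apply: contrapT => infA.
have [m muB] := pm_measureP mu mB bB.
have [C CA Cm] := infinite_set_fset m.+1 infA.
have finC : finite_set [set` C] by exact: finite_fset.
have : mu [set` C] <= mu B.
  apply: le_measure; rewrite ?inE//; first exact: measurable_finite_set.
  by move=> x /CA[].
rewrite muB leNgt => /negP; apply.
rewrite measure_finite_set//.
apply: (@lt_le_trans _ _ (1 * #|` fset_set [set` C]|%:R)%:E).
  by rewrite set_fsetK mul1r lte_fin ltr_nat.
rewrite -sum_finite_set_cst//; apply: lee_fsum => // x /CA[_ mux].
have [n mun] := point_measure_singleton mu x.
suff : 1 <= n%:R%:E :> \bar R by rewrite -mun.
by move: mux; rewrite mun -[0]/(0%:R%:E) eqe eqr_nat -lt0n lee_fin ler1n.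
Qed.

Lemma finite_atoms B mu k : measurable B -> is_bounded B -> (0 < k)%N ->
  finite_set (atoms B mu k).
Proof.
move=> mB bB k0; apply: sub_finite_set (finite_charged mu mB bB) => x.
move=> [Bx mux]; split => //; apply/eqP => /(etrans (esym mux))/eqP.
by rewrite -[0]/(0%:R%:E) eqe eqr_nat eqn0Ngt k0.
Qed.

Lemma measure_atoms B mu k : measurable B -> is_bounded B -> (0 < k)%N ->
  mu (atoms B mu k) = (k%:R * (multiplicity_count B mu k)%:R)%:E.
Proof.
move=> mB bB k0; have finA := finite_atoms mu mB bB k0.
rewrite measure_finite_set// (eq_fsbigr (fun=> k%:R%:E)); last first.
  by move=> x; rewrite inE => -[].
exact: sum_finite_set_cst.
Qed.

Lemma diffuse_finite_set (kappa : {measure set (borel X) -> \bar R})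
  (A : set (borel X)) : diffuse kappa -> finite_set A -> kappa A = 0.
Proof.
by move=> dk finA; rewrite measure_finite_set// fsbig1// => x _; exact: dk.
Qed.

(** All but finitely many points of B have mass 0 under mu. *)
Lemma diffuse_atoms (kappa : {measure set (borel X) -> \bar R}) B mu k :
    diffuse kappa -> measurable B -> is_bounded B ->
  kappa (atoms B mu k) = if k is 0%N then kappa B else 0.
Proof.
move=> dk mB bB; case: k => [|k]; last first.
  exact/diffuse_finite_set/finite_atoms.
have finC := finite_charged mu mB bB.
have mC := measurable_finite_set finC.
rewrite -(measureU0 _ mC (diffuse_finite_set dk finC)).
  congr (kappa _); apply/seteqP; split => [x [[]|[]]//|x Bx].
  by case: (eqVneq (mu [set x]) 0) => mux; [left|right].
exact: measurable_atoms.
Qed.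

(** Restriction to a bounded set turns the map from a configuration to the
measure that it is into a kernel with finite values, for which sections of
jointly measurable sets have measurable mass. *)
Lemma mass_section_measurable B (A : set (pointMeasure X * borel X)) :
    measurable B -> is_bounded B -> measurable A ->
  measurable_fun setT (fun mu : pointMeasure X => mu (xsection A mu `&` B)).
Proof.
move=> mB bB mA.
pose k (mu : pointMeasure X) : {measure set (borel X) -> \bar R} :=
  mrestr mu mB.
have kM U : measurable U -> measurable_fun setT (k ^~ U).
  move=> mU; rewrite /k/= /mrestr; apply: measurable_evaluation.
    exact: measurableI.
  by apply: is_boundedS bB => x [].
pose K := HB.pack_for (R.-ker (pointMeasure X) ~> (borel X)) k
  (isKernel.Build _ _ _ _ R k kM).
have [|_] := @measurable_prod_subset_xsection_kernel _ _ _ _ R K _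
  measurableT _ _ mA.
  move=> mu; have [n muB] := pm_measureP mu mB bB.
  exists n.+1%:R%R => U mU; rewrite /= /mrestr/= /mrestr setIT.
  apply: (@le_lt_trans _ _ (mu B)).
    by apply: le_measure; rewrite ?inE//; exact: measurableI.
  by rewrite muB lte_fin ltr_nat.
by under [X in measurable_fun _ X]eq_fun do rewrite /= /mrestr/= /mrestr setIT.
Qed.

Lemma measurable_mass_atoms B k : measurable B -> is_bounded B ->
  measurable_fun [set: pointMeasure X] (fun mu => mu (atoms B mu k)).
Proof.
move=> mB bB.
have := mass_section_measurable mB bB (measurable_graph_atoms k mB).
congr measurable_fun; apply/funext => mu; congr (mu _).
apply/seteqP; split => x; rewrite /xsection/= inE; first by case.
by move=> ax; split => //; case: ax.
Qed.

Lemma add_pointE mu x (A : set (borel X)) :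
  add_point mu x A = mu A + \d_x A.
Proof. by rewrite [LHS]measure_addE. Qed.

Lemma add_point_singleton mu (x y : borel X) :
  add_point mu x [set y] = mu [set y] + (x == y)%:R%:E.
Proof.
rewrite add_pointE diracE; congr (_ + (nat_of_bool _)%:R%:E).
by apply/idP/eqP => [|->]; rewrite inE.
Qed.

Lemma add_point_singleton_eq mu (x : borel X) k :
  (add_point mu x [set x] = k.+1%:R%:E) <-> (mu [set x] = k%:R%:E).
Proof.
rewrite add_point_singleton eqxx -natr1 EFinD.
split => [/eqP|-> //]; have [n ->] := point_measure_singleton mu x.
by rewrite -!EFinD !natr1 eqe eqr_nat eqSS => /eqP ->.
Qed.

(** The new atom at x has weight i+1, and it had weight i < k before: so no atom
of weight k is destroyed, and one is created exactly when i+1 = k. *)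
Lemma mass_atoms_add_point B mu (x : borel X) i k :
    measurable B -> is_bounded B -> B x -> mu [set x] = i%:R%:E ->
    (i < k)%N ->
  add_point mu x (atoms B (add_point mu x) k) =
  mu (atoms B mu k) + (if i.+1 == k then k%:R else 0)%:E.
Proof.
move=> mB bB Bx mux ik.
have offx (y : borel X) : x <> y -> add_point mu x [set y] = mu [set y].
  by move=> /eqP/negbTE xy; rewrite add_point_singleton xy adde0.
have atx : add_point mu x [set x] = i.+1%:R%:E by apply/add_point_singleton_eq.
have xNa : ~ atoms B mu k x.
  by move=> [_ /(etrans (esym mux))/eqP]; rewrite eqe eqr_nat ltn_eqF.
have [ik1|ik1] := eqVneq i.+1 k.
  rewrite -{}ik1 in xNa *.
  rewrite (_ : atoms _ _ _ = atoms B mu i.+1 `|` [set x]).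
    rewrite add_pointE diracE mem_set; last by right.
    transitivity (mu (atoms B mu i.+1) + mu [set x] + 1); last first.
      by rewrite mux -addeA -EFinD natr1.
    congr (_ + _); rewrite measureU//.
    - exact: measurable_atoms.
    - exact: measurable_singleton.
    - by apply/seteqP; split => // y [ay xy]; apply: xNa; rewrite -xy.
  apply/seteqP; split => [y [By ay]|y [[By ay]|->//]].
    have [xy|xy] := pselect (x = y); first by right.
    by left; split => //; rewrite -offx.
  split => //; rewrite offx// => xy; apply: xNa.
  by rewrite xy.
rewrite (_ : atoms _ _ _ = atoms B mu k).
  by rewrite add_pointE diracE memNset.
apply/seteqP; split => y [By ay].
  have [xy|xy] := pselect (x = y); last by split => //; rewrite -offx.
  move: ay; rewrite -xy => /(etrans (esym atx))/eqP.
  by rewrite eqe eqr_nat (negbTE ik1).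
split => //; rewrite offx// => xy; apply: xNa.
by rewrite xy.
Qed.

End atoms.

(** * First and second moments under the Polya sum law *)

Lemma integral_probability_cst d (T : measurableType d) (R : realType)
  (S : probability T R) (c : R) : \int[S]_x c%:E = c%:E.
Proof.
rewrite integral_cst//; transitivity (c%:E * 1); last by rewrite mule1.
by congr (_ * _); exact: probability_setT.
Qed.

Section polya_moments.
Context (R : realType) (X : polishType R).
Implicit Types (mu : pointMeasure X) (k i : nat).
Variables (B : set (borel X)).
Hypotheses (mB : measurable B) (bB : is_bounded B).

Definition atom_mass k mu : R := fine (mu (atoms B mu k)).

Lemma atom_massE k mu : mu (atoms B mu k) = (atom_mass k mu)%:E.
Proof.
rewrite /atom_mass; have mA := measurable_atoms mu k mB.
by have [n ->] := pm_measureP mu mA (is_bounded_atoms mu k bB).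
Qed.

Lemma atom_mass_ge0 k mu : (0 <= atom_mass k mu)%R.
Proof. exact: fine_ge0. Qed.

Lemma measurable_atom_mass k : measurable_fun setT (atom_mass k).
Proof.
apply: (@measurableT_comp _ _ _ _ _ _ (@fine R)) => //.
exact: measurable_mass_atoms.
Qed.

Lemma atom_mass0 mu : atom_mass 0 mu = 0%R.
Proof. by rewrite /atom_mass null_atoms0. Qed.

Lemma atom_mass_add_point mu (x : borel X) i k :
    B x -> mu [set x] = i%:R%:E -> (i < k)%N ->
  atom_mass k (add_point mu x) =
  (atom_mass k mu + (if i.+1 == k then k%:R else 0))%R.
Proof.
move=> Bx mux ik.
by rewrite {1}/atom_mass (mass_atoms_add_point _ _ Bx mux)// atom_massE.
Qed.

Variables (z : R) (kappa : {measure set (borel X) -> \bar R}).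
Variable S : probability (pointMeasure X) R.
Hypotheses (z0 : (0 <= z)%R) (kappa_lf : locally_finite kappa).
Hypotheses (kappa_diffuse : diffuse kappa) (S_polya : polya_sum z kappa S).

Let b : R := fine (kappa B).

Lemma kappa_massE : kappa B = b%:E.
Proof. by rewrite fineK// ge0_fin_numE// kappa_lf. Qed.

Lemma kappa_mass_ge0 : (0 <= b)%R.
Proof. exact: fine_ge0. Qed.

Lemma integral_indic_atoms (nu : {measure set (borel X) -> \bar R}) (c : R)
    mu k : (0 <= c)%R ->
  \int[nu]_x (c * \1_(atoms B mu k) x)%:E = c%:E * nu (atoms B mu k).
Proof.
move=> c0; have mA := measurable_atoms mu k mB.
under eq_integral do rewrite EFinM.
rewrite ge0_integralZl_EFin//.
- by rewrite integral_indic// setIT.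
- by apply/measurable_EFinP; exact: measurable_indic.
Qed.

(** The defining identity of the Polya sum law tested on
h(x, mu) = 1[x in B, mu{x} = i+1] F(mu). After a point has been added at x the
indicator says mu{x} = i; integrating it against kappa gives kappa(B) if i = 0
and 0 otherwise, and integrating it against mu gives the mass of the atoms of
weight i. *)
Lemma polya_sum_atom_recursion (F : pointMeasure X -> R) (c : R) i :
    measurable_fun setT F -> (forall mu, 0 <= F mu)%R -> (0 <= c)%R ->
    (forall mu (x : borel X), B x -> mu [set x] = i%:R%:E ->
      F (add_point mu x) = F mu + c)%R ->
  \int[S]_mu (atom_mass i.+1 mu * F mu)%:E =
  z%:E * \int[S]_mu (((if i is 0%N then b else 0) + atom_mass i mu)
                     * (F mu + c))%:E.
Proof.
move=> mF F0 c0 Fadd.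
pose h (p : borel X * pointMeasure X) :=
  (F p.2 * \1_[set q : pointMeasure X * borel X | atoms B q.1 i.+1 q.2]
             (p.2, p.1))%:E.
have mh : measurable_fun setT h.
  apply/measurable_EFinP; apply: measurable_funM.
    exact: measurableT_comp.
  apply: measurableT_comp; last exact: measurable_fun_pair.
  by apply: measurable_indic; exact: measurable_graph_atoms.
have h0 p : 0 <= h p by rewrite lee_fin mulr_ge0.
have indE mu x k : \1_[set q : pointMeasure X * borel X | atoms B q.1 k q.2]
    (mu, x) = \1_(atoms B mu k) x :> R.
  rewrite !indicE; have [ax|nax] := pselect (atoms B mu k x).
    by rewrite !mem_set.
  by rewrite !memNset.
have := S_polya mh h0.
rewrite (eq_integral (fun mu => (atom_mass i.+1 mu * F mu)%:E)); last first.
  move=> mu _; rewrite /h/=.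
  under eq_integral do rewrite /= indE.
  by rewrite integral_indic_atoms// atom_massE -EFinM mulrC.
move=> ->.
rewrite -ge0_integralZl_EFin//; last 2 first.
- move=> mu _; rewrite lee_fin mulr_ge0// addr_ge0// ?atom_mass_ge0//.
  by case: i {Fadd h mh h0}; rewrite // kappa_mass_ge0.
- apply/measurable_EFinP; apply: measurable_funM; apply: measurable_funD => //.
  exact: measurable_atom_mass.
apply: eq_integral => mu _; congr (_ * _).
rewrite (eq_integral (fun x => ((F mu + c) * \1_(atoms B mu i) x)%:E)).
  rewrite ge0_integral_measure_add//; last 2 first.
  - by move=> x _; rewrite lee_fin mulr_ge0// addr_ge0.
  - apply/measurable_EFinP; apply: measurable_funM => //.
    by apply: measurable_indic; exact: measurable_atoms.
  rewrite !integral_indic_atoms ?addr_ge0// diffuse_atoms// atom_massE.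
  rewrite -ge0_muleDr// ?kappa_massE; last 2 first.
  - by case: i {Fadd h mh h0}; rewrite // lee_fin kappa_mass_ge0.
  - by rewrite lee_fin atom_mass_ge0.
  case: i {Fadd h mh h0} => [|i]; first by rewrite -EFinD -EFinM mulrC.
  by rewrite -EFinD -EFinM mulrC.
move=> x _; rewrite /h/= indE; congr EFin.
have [ax|nax] := pselect (atoms B mu i x).
  have [Bx mux] := ax.
  rewrite Fadd//; congr (_ * _)%R; rewrite !indicE !mem_set//.
  by split => //; apply/add_point_singleton_eq.
rewrite !indicE (memNset nax) memNset ?mulr0// => -[Bx mux].
by apply: nax; split => //; apply/add_point_singleton_eq.
Qed.

Let m k : R := (z ^+ k * b)%R.

Lemma polya_sum_mean k : \int[S]_mu (atom_mass k.+1 mu)%:E = (m k.+1)%:E.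
Proof.
elim: k => [|k IH].
  have := @polya_sum_atom_recursion (cst 1%R) 0%R 0 _ _ _ _.
  rewrite /=; under eq_integral do rewrite mulr1.
  under [X in _ = _ * X]eq_integral do rewrite atom_mass0 !addr0 mulr1.
  move=> ->//; last by move=> *; rewrite addr0.
  by rewrite integral_probability_cst -EFinM /m expr1.
have := @polya_sum_atom_recursion (cst 1%R) 0%R k.+1 _ _ _ _.
rewrite /=; under eq_integral do rewrite mulr1.
under [X in _ = _ * X]eq_integral do rewrite add0r addr0 mulr1.
move=> ->//; last by move=> *; rewrite addr0.
by rewrite IH -EFinM mulrA -exprS.
Qed.

Lemma integral_massD k (c c' : R) : (0 <= c)%R -> (0 <= c')%R ->
  \int[S]_mu (c * atom_mass k.+1 mu + c')%:E = (c * m k.+1 + c')%:E.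
Proof.
move=> c0 c'0; under eq_integral do rewrite EFinD EFinM.
rewrite ge0_integralD//.
- rewrite ge0_integralZl_EFin//.
  + by rewrite polya_sum_mean integral_probability_cst.
  + by move=> mu _; rewrite lee_fin atom_mass_ge0.
  + by apply/measurable_EFinP; exact: measurable_atom_mass.
- by move=> mu _; rewrite -EFinM lee_fin mulr_ge0// atom_mass_ge0.
- apply: measurable_funeM; apply/measurable_EFinP.
  exact: measurable_atom_mass.
Qed.

(** For i < k a new point at an atom of weight at most i creates no atom of
weight k+1, so the recursion for E[a_(i+1) a_(k+1)] is that of the means,
multiplied by E[a_(k+1)]. *)
Lemma polya_sum_cross_moment i k : (i < k)%N ->
  \int[S]_mu (atom_mass i.+1 mu * atom_mass k.+1 mu)%:E =
  (m i.+1 * m k.+1)%:E.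
Proof.
elim: i => [|i IH] ik.
  rewrite (@polya_sum_atom_recursion (atom_mass k.+1) 0%R)//.
  - under eq_integral do rewrite atom_mass0 !addr0 -[(_ * _)%R]addr0.
    rewrite integral_massD// ?kappa_mass_ge0// -EFinM addr0.
    by rewrite /m expr1 !mulrA.
  - exact: measurable_atom_mass.
  - exact: atom_mass_ge0.
  - move=> mu x Bx mux; rewrite (atom_mass_add_point Bx mux)//.
    by rewrite eqSS ltn_eqF.
rewrite (@polya_sum_atom_recursion (atom_mass k.+1) 0%R)//.
- under eq_integral do rewrite add0r addr0.
  rewrite IH ?(ltnW ik)// -EFinM mulrA; congr (_ * _)%:E.
  by rewrite /m mulrA -exprS.
- exact: measurable_atom_mass.
- exact: atom_mass_ge0.
- move=> mu x Bx mux; rewrite (atom_mass_add_point Bx mux)//.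
    by rewrite eqSS ltn_eqF.
  by rewrite ltnS ltnW.
Qed.

(** The last step of the recursion is the only one in which a new point raises
the mass a_(k+1), by k+1; this produces the additional term. *)
Lemma polya_sum_second_moment k :
  \int[S]_mu (atom_mass k.+1 mu ^+ 2)%:E = (m k.+1 ^+ 2 + k.+1%:R * m k.+1)%:E.
Proof.
under eq_integral do rewrite expr2.
rewrite (@polya_sum_atom_recursion (atom_mass k.+1) k.+1%:R)//; last 3 first.
- exact: measurable_atom_mass.
- exact: atom_mass_ge0.
- by move=> mu x Bx mux; rewrite (atom_mass_add_point Bx mux)// eqxx.
case: k => [|k].
  under eq_integral do rewrite atom_mass0 addr0 mulrDr mulr1.
  rewrite integral_massD ?kappa_mass_ge0// -EFinM; congr EFin.
  rewrite /m; ring.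
under eq_integral do rewrite add0r mulrDr EFinD.
rewrite ge0_integralD//.
- rewrite polya_sum_cross_moment//.
  under eq_integral do rewrite mulrC -[(_ * _)%R]addr0.
  rewrite integral_massD// -EFinD -EFinM; congr EFin.
  have -> : m k.+2 = (z * m k.+1)%R by rewrite /m exprS mulrA.
  ring.
- by move=> mu _; rewrite lee_fin mulr_ge0// atom_mass_ge0.
- apply/measurable_EFinP; apply: measurable_funM; exact: measurable_atom_mass.
- by move=> mu _; rewrite lee_fin mulr_ge0// atom_mass_ge0.
- apply/measurable_EFinP; apply: measurable_funM => //.
  exact: measurable_atom_mass.
Qed.

(** The square is expanded with all terms on the side where they are
nonnegative, so that only integrals of nonnegative functions occur. *)
Lemma polya_sum_variance k :
  \int[S]_mu ((atom_mass k.+1 mu - m k.+1) ^+ 2)%:E = (k.+1%:R * m k.+1)%:E.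
Proof.
have m0 : (0 <= m k.+1)%R by rewrite mulr_ge0// ?exprn_ge0// kappa_mass_ge0.
have mN := measurable_atom_mass k.+1.
have N0 := atom_mass_ge0 k.+1.
have : \int[S]_mu ((atom_mass k.+1 mu - m k.+1) ^+ 2)%:E +
    \int[S]_mu (2 * m k.+1 * atom_mass k.+1 mu + 0)%:E =
  \int[S]_mu (atom_mass k.+1 mu ^+ 2)%:E + \int[S]_mu (m k.+1 ^+ 2)%:E.
  rewrite -!ge0_integralD//.
  - apply: eq_integral => mu _; rewrite -!EFinD; congr EFin.
    ring.
  - by move=> mu _; rewrite lee_fin sqr_ge0.
  - apply/measurable_EFinP; exact: measurable_funX.
  - by move=> mu _; rewrite lee_fin sqr_ge0.
  - by move=> mu _; rewrite lee_fin sqr_ge0.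
  - apply/measurable_EFinP; apply: measurable_funX.
    exact: measurable_funB.
  - by move=> mu _; rewrite lee_fin addr0; do 2 apply: mulr_ge0 => //.
  - apply/measurable_EFinP; apply: measurable_funD => //.
    exact: measurable_funM.
rewrite (integral_massD k (mulr_ge0 (ler0n R 2) m0) (lexx 0%R)).
rewrite polya_sum_second_moment.
rewrite integral_probability_cst -EFinD.
move=> /(congr1 (fun y => y - (2 * m k.+1 * m k.+1 + 0)%:E)).
rewrite addeK// => ->; rewrite -EFinB; congr EFin; ring.
Qed.

End polya_moments.

(** * A strong law for increasing sequences under a variance bound *)

Section strong_law.
Context (R : realType).
Local Open Scope ring_scope.

Section lacunary.
Variable a : nat -> R.
Hypothesis a_ubounded : forall M : R, exists n, M <= a n.

Lemma first_passage : exists lo : nat -> nat, forall k,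
  k.+1%:R ^+ 2 <= a (lo k) /\ forall n, (n < lo k)%N -> a n < k.+1%:R ^+ 2.
Proof.
suff /choice[lo lo_spec] : forall k, exists m,
    k.+1%:R ^+ 2 <= a m /\ forall n, (n < m)%N -> a n < k.+1%:R ^+ 2.
  by exists lo.
move=> k; have [n an nmin] := ex_minnP (a_ubounded (k.+1%:R ^+ 2)).
exists n; split => // i ni.
by rewrite ltNge; apply/negP => /nmin; rewrite leqNgt ni.
Qed.

Variables (x : nat -> R) (c : R) (lo : nat -> nat).
Hypothesis a_nd : forall m n, (m <= n)%N -> a m <= a n.
Hypothesis a_gt0 : forall n, 0 < a n.
Hypothesis x_nd : forall m n, (m <= n)%N -> x m <= x n.
Hypothesis x_ge0 : forall n, 0 <= x n.
Hypothesis lo_spec : forall k,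
  k.+1%:R ^+ 2 <= a (lo k) /\ forall n, (n < lo k)%N -> a n < k.+1%:R ^+ 2.

(** The last index before a reaches (k+2)^2, except when a jumps over
[(k+1)^2, (k+2)^2): there the first index of the block is taken instead, which
keeps the value of a at least (k+1)^2. *)
Definition block_end k := maxn (lo k) (lo k.+1).-1.

Lemma le_block_end k : k.+1%:R ^+ 2 <= a (block_end k).
Proof. by apply: le_trans (lo_spec k).1 (a_nd _); exact: leq_maxl. Qed.

(** The ratio ((k+1) / (k+2))^2 of the bounds of a block, in the form that shows
its limit. *)
Let q (k : nat) : R := (1 - k.+2%:R^-1) ^+ 2.

Let qE k : q k = k.+1%:R ^+ 2 / k.+2%:R ^+ 2.
Proof.
rewrite /q -expr_div_n; congr (_ ^+ _).
have k0 : k.+2%:R != 0 :> R by rewrite pnatr_eq0.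
by apply: (mulIf k0); rewrite mulrBl mul1r mulVf// mulfVK// -natr1 addrK.
Qed.

Let q_cvg : q @ \oo --> (1 : R).
Proof.
rewrite -[X in _ --> X](expr1n _ 2) -[X in X ^+ _](subr0 1).
apply: (@cvg_comp _ _ _ (fun k => 1 - k.+2%:R^-1) (fun y => y ^+ 2) _
  (nbhs (1 - 0 : R))); last exact: exprn_continuous.
apply: cvgB; first exact: cvg_cst.
by have := @cvg_harmonic R; rewrite -cvg_shiftS.
Qed.

(** The block of n: the k with (k+1)^2 <= a n < (k+2)^2, once a n >= 1. *)
Let idx n := (Num.truncn (Num.sqrt (a n))).-1.

Let idx_cvg : idx @ \oo --> \oo.
Proof.
apply/cvgnyPge => A; have [n An] := a_ubounded (A.+1%:R ^+ 2).
exists n => // i /= ni; rewrite /idx -ltnS.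
have : (A.+1 <= Num.truncn (Num.sqrt (a i)))%N.
  rewrite truncn_ge_nat ?sqrtr_ge0//.
  rewrite -(@ler_pXn2r _ 2) ?nnegrE ?sqrtr_ge0// sqr_sqrtr ?(ltW (a_gt0 _))//.
  exact: le_trans An (a_nd ni).
by case: Num.truncn.
Qed.

Let idx_bounds n : 1 <= a n ->
  (idx n).+1%:R ^+ 2 <= a n < (idx n).+2%:R ^+ 2.
Proof.
move=> an1; rewrite /idx; set s := Num.sqrt (a n).
have s0 : 0 <= s by exact: sqrtr_ge0.
have sE : a n = s ^+ 2 by rewrite sqr_sqrtr// ltW.
have s1 : 1 <= s.
  by rewrite -(@ler_pXn2r _ 2) ?nnegrE// expr1n -sE.
have /andP[l u] := truncn_itv s0.
rewrite prednK ?truncn_gt0// sE.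
by rewrite ler_pXn2r ?ltr_pXn2r ?nnegrE// l u.
Qed.

(** Within a block x lies between its values at the ends, and a varies at most
by the factor ((k+2) / (k+1))^2. *)
Lemma cvg_ratio_of_block_ends :
    (fun k => x (lo k) / a (lo k)) @ \oo --> c ->
    (fun k => x (block_end k) / a (block_end k)) @ \oo --> c ->
  (fun n => x n / a n) @ \oo --> c.
Proof.
move=> lo_cvg hi_cvg.
apply: (@squeeze_cvgr _ _ _ _
  (fun n => x (lo (idx n)) / a (lo (idx n)) * q (idx n))
  (fun n => x (block_end (idx n)) / a (block_end (idx n)) / q (idx n)) _ _ c).
- have [N aN] := a_ubounded 1.
  exists N => // n /= Nn.
  have an1 : 1 <= a n := le_trans aN (a_nd Nn).
  have /andP[ln nu] := idx_bounds an1.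
  set k := idx n in ln nu *.
  have k1 : 0 < k.+1%:R ^+ 2 :> R by rewrite exprn_gt0.
  have k2 : 0 < k.+2%:R ^+ 2 :> R by rewrite exprn_gt0.
  have lon : (lo k <= n)%N.
    by rewrite leqNgt; apply/negP => /(lo_spec k).2; rewrite ltNge ln.
  have nlo : (n < lo k.+1)%N.
    rewrite ltnNge; apply/negP => /a_nd lea.
    by move: nu; rewrite ltNge (le_trans (lo_spec k.+1).1 lea).
  have hiE : block_end k = (lo k.+1).-1.
    by apply/maxn_idPr; rewrite -ltnS (ltn_predK nlo) (leq_ltn_trans lon).
  have nhi : (n <= block_end k)%N by rewrite hiE -ltnS (ltn_predK nlo).
  have hiu : a (block_end k) < k.+2%:R ^+ 2.
    by apply: (lo_spec k.+1).2; rewrite hiE (ltn_predK nlo).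
  rewrite qE invf_div; apply/andP; split.
    apply: (@le_trans _ _ (x n / k.+2%:R ^+ 2)).
      rewrite mulrA ler_pM2r ?invr_gt0// -mulrA.
      apply: le_trans (x_nd lon); rewrite ler_piMr//.
      by rewrite mulrC ler_pdivrMr// mul1r (lo_spec k).1.
    by rewrite ler_wpM2l// lef_pV2 ?posrE// ltW.
  apply: (@le_trans _ _ (x n / k.+1%:R ^+ 2)).
    by rewrite ler_wpM2l// lef_pV2 ?posrE.
  rewrite mulrA ler_pM2r ?invr_gt0// -mulrA.
  apply: (le_trans (x_nd nhi)); rewrite ler_peMr//.
  by rewrite mulrC ler_pdivlMr// mul1r ltW.
- rewrite -[X in _ --> X]mulr1.
  exact: (cvgM (cvg_comp _ _ idx_cvg lo_cvg) (cvg_comp _ _ idx_cvg q_cvg)).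
- rewrite -[X in _ --> X](divr1 c).
  apply: (cvgM (cvg_comp _ _ idx_cvg hi_cvg)).
  by apply: cvgV; [exact: oner_neq0 | exact: (cvg_comp _ _ idx_cvg q_cvg)].
Qed.

End lacunary.

Lemma nneseries_inv_square_lty :
  (\sum_(0 <= k <oo) (k.+1%:R ^- 2 : R)%:E < +oo)%E.
Proof.
(* The bound telescopes: 1/m^2 <= 2/m - 2/(m+1) for m >= 1. *)
have bound n : \sum_(0 <= k < n) (k.+1%:R ^- 2 : R) <= 2 - 2 / n.+1%:R.
  elim: n => [|n IH]; first by rewrite big_nil invr1 mulr1 subrr.
  rewrite big_nat_recr//=; apply: (le_trans (lerD IH (lexx _))).
  have x0 : 0 < n.+1%:R :> R by [].
  rewrite -subr_ge0 (_ : _ - _ =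
    n%:R / (n.+1%:R ^+ 2 * n.+2%:R)) ?divr_ge0//.
  field.
  by apply/andP; split; apply: lt0r_neq0; rewrite ltr_wpDr.
apply: (@le_lt_trans _ _ (2%:R%:E)%E); last exact: ltry.
apply: lime_le.
  by apply: is_cvg_nneseries => n _ _; rewrite lee_fin invr_ge0 exprn_ge0.
apply: nearW => n; rewrite sumEFin lee_fin.
by rewrite (le_trans (bound n))// gerBl divr_ge0.
Qed.

Context d (T : measurableType d).

Lemma measurable_cvg_set (f : nat -> T -> R) (c : R) :
    (forall n, measurable_fun setT (f n)) ->
  measurable [set w | (f n w) @[n --> \oo] --> c].
Proof.
move=> mf.
rewrite (_ : mkset _ = \bigcap_k \bigcup_m \bigcap_(n in [set n | (m <= n)%N])
    [set w | `|c - f n w| < k.+1%:R^-1]).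
  apply: bigcapT_measurable => k; apply: bigcupT_measurable => m.
  apply: bigcap_measurable => [|n _]; first by exists m => /=.
  have mg : measurable_fun setT (fun w => `|c - f n w|).
    apply: measurableT_comp => //; exact: measurable_funB.
  have := mg measurableT _ (measurable_itv `]-oo, (k.+1%:R^-1 : R)[).
  by rewrite setTI; congr measurable; apply/seteqP; split => w;
    rewrite /= in_itv.
apply/seteqP; split => w /=.
  move=> /cvgrPdist_lt fc k _.
  have /fc[m _ mP] : (0 : R) < k.+1%:R^-1 by [].
  by exists m => // n mn; exact: mP.
move=> H; apply/cvgrPdist_lt => e e0.
have [m _ mP] := H (Num.truncn e^-1) Logic.I.
exists m => // n mn; apply: lt_trans (mP n mn) _.
by rewrite -[ltRHS]invrK ltf_pV2 ?posrE ?invr_gt0// truncnS_gt.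
Qed.

Variables (S : probability T R) (N : nat -> T -> R) (a : nat -> R) (c C : R).
Hypothesis mN : forall n, measurable_fun setT (N n).
Hypothesis a_gt0 : forall n, 0 < a n.
Hypothesis N_var : forall n,
  (\int[S]_w ((N n w - c * a n) ^+ 2)%:E <= (C * a n)%:E)%E.

(** The squared relative errors along e have expectations at most C / (k+1)^2;
their sum has finite expectation, so it is almost surely finite and its terms
tend to 0. *)
Lemma ae_cvg_ratio_subseq (e : nat -> nat) :
    (forall k, k.+1%:R ^+ 2 <= a (e k)) ->
  {ae S, forall w, (fun k => N (e k) w / a (e k)) @ \oo --> c}.
Proof.
move=> ae_ge.
pose D k w : R := (N (e k) w / a (e k) - c) ^+ 2.
have D0 k w : 0 <= D k w by exact: sqr_ge0.
have mD k : measurable_fun setT (D k).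
  by apply/measurable_funX/measurable_funB => //; exact: measurable_funM.
have C0 : 0 <= C.
  have : (0 <= (C * a 0)%:E)%E.
    apply: le_trans (N_var 0%N); apply: integral_ge0 => w _.
    by rewrite lee_fin sqr_ge0.
  by rewrite lee_fin pmulr_lge0.
have intD k : (\int[S]_w (D k w)%:E <= C%:E * (k.+1%:R ^- 2)%:E)%E.
  have ak := a_gt0 (e k).
  rewrite (eq_integral (fun w => ((a (e k)) ^- 2)%:E *
    ((N (e k) w - c * a (e k)) ^+ 2)%:E)%E); last first.
    move=> w _; rewrite -EFinM /D; congr EFin.
    rewrite -exprVn -exprMn; congr (_ ^+ 2); rewrite mulrBr.
    congr (_ - _); first by rewrite mulrC.
    by rewrite mulrCA mulVf ?mulr1 ?gt_eqF.
  rewrite ge0_integralZl_EFin//; last 3 first.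
  - by move=> w _; rewrite lee_fin sqr_ge0.
  - apply/measurable_EFinP/measurable_funX/measurable_funB => //.
  - by rewrite invr_ge0 sqr_ge0.
  apply: (@le_trans _ _ ((a (e k)) ^- 2 * (C * a (e k)))%:E).
    by rewrite EFinM lee_pmul2l ?lte_fin ?invr_gt0 ?exprn_gt0.
  rewrite -EFinM lee_fin mulrCA ler_wpM2l//.
  rewrite expr2 invfM -mulrA mulVf ?gt_eqF// mulr1.
  by rewrite lef_pV2 ?posrE ?exprn_gt0.
have sumD : (\int[S]_w (\sum_(0 <= k <oo) (D k w)%:E) < +oo)%E.
  rewrite integral_nneseries//; last 2 first.
  - by move=> k; exact/measurable_EFinP.
  - by move=> k w _; rewrite lee_fin.
  apply: (@le_lt_trans _ _ (\sum_(0 <= k <oo) C%:E * (k.+1%:R ^- 2)%:E)%E).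
    apply: lee_nneseries => // k _ _; apply: integral_ge0 => w _.
    by rewrite lee_fin.
  rewrite nneseriesZl//.
  apply: lte_mul_pinfty => //; exact: nneseries_inv_square_lty.
have intsum : S.-integrable setT (fun w => (\sum_(0 <= k <oo) (D k w)%:E)%E).
  apply/integrableP; split.
    apply: ge0_emeasurable_sum => [k w _ _|k _]; first by rewrite lee_fin.
    exact/measurable_EFinP.
  rewrite (eq_integral (fun w => \sum_(0 <= k <oo) (D k w)%:E)%E)// => w _.
  by rewrite gee0_abs// nneseries_ge0// => k _ _; rewrite lee_fin.
apply: filterS (integrable_ae measurableT intsum) => w /(_ Logic.I).
rewrite ge0_fin_numE; last by apply: nneseries_ge0 => k _ _; rewrite lee_fin.
move=> /(nnseries_is_cvg (D0^~ w)).
move=> /cvg_series_cvg_0 Dcvg.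
apply/cvgrPdist_lt => eps eps0.
have eps2 : 0 < eps ^+ 2 by rewrite exprn_gt0.
move/cvgrPdist_lt : Dcvg => /(_ _ eps2).
apply: filterS => k; rewrite sub0r normrN ger0_norm// /D.
by rewrite -real_normK ?num_real// distrC ltr_pXn2r ?nnegrE// ltW.
Qed.

(** Both ends of the blocks satisfy the growth condition of the previous lemma,
and monotonicity fills in the indices between them. *)
Lemma monotone_strong_law :
    (forall m n, (m <= n)%N -> a m <= a n) -> (forall M, exists n, M <= a n) ->
    (forall w m n, (m <= n)%N -> N m w <= N n w) -> (forall n w, 0 <= N n w) ->
  {ae S, forall w, (fun n => N n w / a n) @ \oo --> c}.
Proof.
move=> a_nd a_ub N_nd N_ge0.
have [lo lo_spec] := first_passage a_ub.
have lo_cvg := ae_cvg_ratio_subseq (fun k => (lo_spec k).1).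
have hi_cvg := ae_cvg_ratio_subseq (le_block_end a_nd lo_spec).
apply: filterS2 lo_cvg hi_cvg => w.
exact: (cvg_ratio_of_block_ends a_ub a_nd a_gt0 (N_nd w) (N_ge0 ^~ w) lo_spec).
Qed.

End strong_law.

(** * Multiplicity frequencies *)

Section frequencies.
Context (R : realType) (X : polishType R).

Lemma weighted_sum_singleton (c : nat -> {nonneg R}) j : (0 < j)%N ->
  weighted_sum c [set j] = (c j)%:num%:E.
Proof.
move=> j0; rewrite /weighted_sum /mseries.
pose f k : \bar R := mscale (c k) (dirac k) [set j].
have fj : f j = (c j)%:num%:E.
  by rewrite /f /mscale/= diracE mem_set// mule1.
have f0 k : k != j -> f k = 0.
  move=> /eqP kj; rewrite /f /mscale/= diracE memNset ?mule0//.
rewrite -[LHS]/(\sum_(1 <= k <oo) f k).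
rewrite (nneseries_split 1 j) => [|k _]; last exact: measure_ge0.
rewrite eseries0 ?adde0 => [|k jk _]; last first.
  by apply: f0; rewrite gtn_eqF// -add1n.
rewrite add1n big_nat_recr//= big_nat big1 ?add0e//.
by move=> k /andP[_ kj]; apply: f0; rewrite ltn_eqF.
Qed.

Lemma V_singleton (rho : {measure set (borel X) -> \bar R}) (B : set (borel X))
    (mu : pointMeasure X) j : measurable B -> is_bounded B -> (0 < j)%N ->
  V rho B mu [set j] = (atom_mass B j mu / fine (rho B) * j%:R^-1)%:E.
Proof.
move=> mB bB j0.
rewrite -[LHS]/(((fine (rho B))^-1)%:E * U B mu [set j]).
rewrite weighted_sum_singleton//=.
rewrite /atom_mass measure_atoms//= -EFinM; congr EFin.
by rewrite [RHS]mulrC !mulrA mulVf ?pnatr_eq0 -?lt0n// mul1r mulrC.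
Qed.

Lemma limit_measure_singleton (t : R) (t0 : (0 <= t)%R) j : (0 < j)%N ->
  limit_measure t0 [set j] = (t ^+ j / j%:R)%:E.
Proof. by move=> j0; rewrite /limit_measure weighted_sum_singleton. Qed.

Variable B : nat -> set (borel X).
Hypothesis B_measurable : forall n, measurable (B n).
Hypothesis B_bounded : forall n, is_bounded (B n).

Section exhaustion.
Hypothesis B_increasing : forall m n, (m <= n)%N -> B m `<=` B n.
Hypothesis B_cover : \bigcup_n B n = setT.

Lemma exhaustion_mass_unbounded (kappa : {measure set (borel X) -> \bar R}) :
    locally_finite kappa -> kappa setT = +oo ->
  forall M : R, exists n, (M <= fine (kappa (B n)))%R.
Proof.
move=> kappa_lf kappa_oo M.
have : kappa \o B @ \oo --> +oo.
  rewrite -kappa_oo -B_cover; apply: nondecreasing_cvg_mu => //.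
    exact: bigcupT_measurable.
  by move=> m n mn; apply/subsetPset/B_increasing.
move=> /cvgeyPge/(_ M)[n _ /(_ n (leqnn n)) /= Mn].
exists n; rewrite -lee_fin fineK// ge0_fin_numE//; exact: kappa_lf.
Qed.

Lemma polya_sum_frequency (z : R) (kappa : {measure set (borel X) -> \bar R})
    (S : probability (pointMeasure X) R) k :
    (0 <= z)%R -> locally_finite kappa -> diffuse kappa -> kappa setT = +oo ->
    (forall n, 0 < kappa (B n)) -> polya_sum z kappa S ->
  {ae S, forall mu,
    (atom_mass (B n) k.+1 mu / fine (kappa (B n)))%R @[n --> \oo]
      --> (z ^+ k.+1)%R}.
Proof.
move=> z0 lf df kappa_oo kappa_pos SP.
have finB n : kappa (B n) \is a fin_num by rewrite ge0_fin_numE// lf.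
apply: (@monotone_strong_law _ _ _ S (fun n mu => atom_mass (B n) k.+1 mu)
  (fun n => fine (kappa (B n))) (z ^+ k.+1)%R (k.+1%:R * z ^+ k.+1)%R).
- by move=> n; exact: measurable_atom_mass.
- by move=> n; apply: fine_gt0; rewrite kappa_pos -ge0_fin_numE ?finB.
- move=> n; rewrite (polya_sum_variance (B_measurable n) (B_bounded n) z0)//.
  by rewrite mulrA.
- move=> m n mn; apply: fine_le => //.
  by apply: le_measure; rewrite ?inE//; exact: B_increasing.
- exact: exhaustion_mass_unbounded.
- move=> mu m n mn; rewrite -lee_fin -!atom_massE//.
  apply: le_measure; rewrite ?inE; [exact: measurable_atoms..|].
  by move=> x [Bx mux]; split => //; exact: (B_increasing mn).
- by move=> n mu; exact: atom_mass_ge0.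
Qed.

End exhaustion.

End frequencies.

(** Applied to Y_t and its increment from time 0, which agree on measurable sets
only. *)
Lemma eq_atom_mass (R : realType) (X : polishType R) (mu nu : pointMeasure X)
    (B : set (borel X)) k : measurable B ->
    (forall A : set (borel X), measurable A -> mu A = nu A) ->
  atom_mass B k mu = atom_mass B k nu.
Proof.
move=> mB munu; rewrite /atom_mass; congr fine.
rewrite munu; last exact: measurable_atoms.
congr (nu _); apply/seteqP; split => x [Bx mux]; split => //.
  by rewrite -munu//; exact: measurable_singleton.
by rewrite munu//; exact: measurable_singleton.
Qed.

Theorem proposition5p2 (R : realType) (X : polishType R)
    (rho : {measure set (borel X) -> \bar R})
    (rho_lf : locally_finite rho) (rho_diffuse : diffuse rho)
    (rho_infinite : rho setT = +oo)
    (d : measure_display) (Omega : measurableType d) (P : probability Omega R)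
    (Y : R -> Omega -> pointMeasure X) (Y_crp : spatial_crp rho P Y)
    (B : nat -> set (borel X))
    (B_measurable : forall n, measurable (B n))
    (B_bounded : forall n, is_bounded (B n))
    (B_increasing : forall m n, (m <= n)%N -> B m `<=` B n)
    (B_cover : \bigcup_n B n = setT)
    (B_pos : forall n, 0 < rho (B n))
    (t : R) (t0 : (0 <= t)%R) (t1 : (t < 1)%R) :
  {ae P, forall w,
    vague_cvg_nat \oo (fun n => V rho (B n) (Y t w)) (limit_measure t0)}.
Proof.
suff freq k : {ae P, forall w,
    (atom_mass (B n) k.+1 (Y t w) / fine (rho (B n)))%R @[n --> \oo]
      --> (t ^+ k.+1)%R}.
  apply: filterS (ae_foralln freq) => w freqw [//|k] _.
  rewrite limit_measure_singleton//.
  under eq_fun do rewrite V_singleton//.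
  apply/cvg_EFin; first exact: nearW.
  by apply: cvgMl; exact: freqw.
pose E := [set mu : pointMeasure X |
  (atom_mass (B n) k.+1 mu / fine (rho (B n)))%R @[n --> \oo]
    --> (t ^+ k.+1)%R].
have mE : measurable E.
  apply: measurable_cvg_set => n; apply: measurable_funM => //.
  exact: measurable_atom_mass.
have Y0 := crp_start Y_crp.
have [t_eq0|t_neq0] := eqVneq t 0%R.
  apply: nearW => w; rewrite t_eq0 expr0n/=.
  rewrite (_ : (fun n => _) = cst 0%R); first exact: cvg_cst.
  apply/funext => n; rewrite /atom_mass Y0 ?mul0r//.
  exact: measurable_atoms.
have t_gt0 : (0 < t)%R by rewrite lt_neqAle eq_sym t_neq0.
have [Z [K [YZ KP KZ]]] := crp_transition Y_crp (lexx 0%R) t_gt0 t1.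
pose kappa w : {measure set (borel X) -> \bar R} := measure_add rho (Y 0%R w).
have kappaE w (A : set (borel X)) : measurable A -> kappa w A = rho A.
  by move=> mA; rewrite [LHS]measure_addE Y0// adde0.
(* Conditionally on Y_0 the increment has a Polya sum law whose second parameter
   rho + Y_0 has the same values as rho. *)
have K0 w : K w (~` E) = 0.
  apply: measure_negligible; first exact: measurableC.
  suff aeE : {ae K w, forall mu, E mu} by exact: aeE.
  have tE : ((t - 0) / (1 - 0) = t :> R)%R by rewrite !subr0 divr1.
  have KPw : polya_sum t (kappa w) (K w) by have := KP w; rewrite tE.
  have : {ae K w, forall mu, (atom_mass (B n) k.+1 mu /
      fine (kappa w (B n)))%R @[n --> \oo] --> (t ^+ k.+1)%R}.
    apply: polya_sum_frequency KPw => //.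
    - by move=> A mA bA; rewrite kappaE//; exact: rho_lf.
    - move=> x; rewrite kappaE; first exact: rho_diffuse.
      exact: measurable_singleton.
    - by rewrite kappaE.
    - by move=> n; rewrite kappaE.
  apply: filterS => mu; rewrite /E/=.
  by under eq_fun do rewrite kappaE//.
have EYZ w : E (Y t w) = E (Z w).
  rewrite /E/=; under eq_fun => n.
    rewrite (@eq_atom_mass _ _ _ (Z w)) => [|//|A mA]; last first.
      by rewrite YZ// Y0// add0e.
    over.
  by [].
have [_ _ /(_ setT)] := KZ (~` E) (measurableC mE).
rewrite integral0_eq// setIT => PZ.
(* The preimage under Y_t is used as the exceptional set because Y_t, unlike
   the increment Z, is known to be measurable. *)
exists (Y t @^-1` (~` E)); split.
- rewrite -[X in measurable X]setTI; apply: (crp_measurable Y_crp) => //.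
  exact: measurableC.
- rewrite (_ : _ @^-1` _ = Z @^-1` (~` E)).
    by apply: PZ; exists setT => //; rewrite preimage_setT setTI.
  by apply/seteqP; split => w; rewrite /preimage/= EYZ.
- by move=> w.
Qed.
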